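(* Let $\sigma\in\mathbb{C}$ and let $M(\sigma)=\begin{pmatrix} Q(\sigma) & C_1\\ C_2^T & P(\sigma)\end{pmatrix}$ be the discretized waveguide matrix defined in the context, where $P(\sigma)$ and $M(\sigma)$ are assumed to be invertible. Let $$S(\sigma):=Q(\sigma)-C_1P(\sigma)^{-1}C_2^T$$ be the Schur complement of $M(\sigma)$ with respect to the block $P(\sigma)$. Let $r\in\mathbb{C}^{n_xn_z+2n_z}$, let $r_{\mathrm{int}}\in\mathbb{C}^{n_xn_z}$ be the vector of the first $n_xn_z$ elements of $r$, and let $r_{\mathrm{ext}}\in\mathbb{C}^{2n_z}$ be the vector of the last $2n_z$ elements of $r$. Then $$M(\sigma)^{-1}r=\begin{pmatrix} q\\ P(\sigma)^{-1}\left(-C_2^Tq+r_{\mathrm{ext}}\right)\end{pmatrix},$$ where $$q:=S(\sigma)^{-1}\tilde r\qquad\text{and}\qquad \tilde r:=r_{\mathrm{int}}-C_1P(\sigma)^{-1}r_{\mathrm{ext}}.$$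
   Context: Notation: $\otimes$ is the Kronecker product, $\mathrm{vec}$ stacks the columns of a matrix into one vector, $I_n$ is the $n\times n$ identity matrix, $e_j$ is the $j$-th standard basis vector (of the appropriate dimension), $\mathrm{diag}(v)$ is the diagonal matrix with the entries of $v$ on its diagonal. Grid: $n_x\ge 2$ is an integer, $n_z=2p+1$ with $p$ a nonnegative integer; $x_-<x_+$ are real; $h_x=(x_+-x_-)/(n_x+1)$, $h_z=1/n_z$; $x_k=x_-+kh_x$ for $k=1,\dots,n_x$ and $z_\ell=\ell h_z$ for $\ell=1,\dots,n_z$. The wavenumber $\kappa(x,z)$ is a given bounded piecewise constant function, $1$-periodic in $z$, equal to constants $\kappa_-$ and $\kappa_+$ for all sufficiently negative, respectively sufficiently positive, $x$. The matrix $K\in\mathbb{C}^{n_z\times n_x}$ is given by $[K]_{k,\ell}=\kappa^2(x_\ell,z_k)$. Difference matrices: let $Z_n\in\mathbb{R}^{n\times n}$ be the shift matrix, $[Z_n]_{k,l}=1$ if $k-l=1$ and $0$ otherwise. Then $D_{xx}=(-2I_{n_x}+Z_{n_x}+Z_{n_x}^T)/h_x^2$, $D_z=(Z_{n_z}+e_1e_{n_z}^T-Z_{n_z}^T-e_{n_z}e_1^T)/(2h_z)$, $D_{zz}=(-2I_{n_z}+Z_{n_z}+e_1e_{n_z}^T+Z_{n_z}^T+e_{n_z}e_1^T)/h_z^2$. Blocks of $M(\gamma)$, for $\gamma\in\mathbb{C}$: $Q(\gamma)=A_0+\gamma A_1+\gamma^2A_2\in\mathbb{C}^{n_xn_z\times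 n_xn_z}$ with $A_0=D_{xx}^T\otimes I_{n_z}+I_{n_x}\otimes D_{zz}+\mathrm{diag}(\mathrm{vec}(K))$, $A_1=2I_{n_x}\otimes D_z$, $A_2=I_{n_xn_z}$; $C_1=\frac{1}{h_x^2}\left(e_1\otimes I_{n_z},\ e_{n_x}\otimes I_{n_z}\right)\in\mathbb{C}^{n_xn_z\times 2n_z}$; $C_2^T=\begin{pmatrix} d_1e_1^T\otimes I_{n_z}+d_2e_2^T\otimes I_{n_z}\\ d_1e_{n_x}^T\otimes I_{n_z}+d_2e_{n_x-1}^T\otimes I_{n_z}\end{pmatrix}\in\mathbb{C}^{2n_z\times n_xn_z}$ with $d_1=\frac{2}{h_x}$, $d_2=-\frac{1}{2h_x}$; $P(\gamma)=\begin{pmatrix}P_-(\gamma)&0\\0&P_+(\gamma)\end{pmatrix}\in\mathbb{C}^{2n_z\times 2n_z}$ with $P_\pm(\gamma)=R\Lambda_\pm(\gamma)R^{-1}$, where $[R]_{k,\ell}=e^{2\pi i(\ell-p-1)kh_z}$ for $k,\ell=1,\dots,n_z$, $\Lambda_\pm(\gamma)=\mathrm{diag}\left(s_{\pm,-p}(\gamma)+d_0,\ s_{\pm,-p+1}(\gamma)+d_0,\dots,s_{\pm,p}(\gamma)+d_0\right)$, $d_0=-\frac{3}{2h_x}$, and $s_{\pm,k}(\gamma)=\mathrm{sign}(\mathrm{Im}(\beta_{\pm,k}(\gamma)))\, i\sqrt{\beta_{\pm,k}(\gamma)}$, $\beta_{\pm,k}(\gamma)=(\gamma+2\pi ik)^2+\kappa_\pm^2$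 (principal square root). *)

(* Defs.v *)
From mathcomp Require Import all_boot all_order all_algebra.
From mathcomp Require Import all_classical all_reals all_analysis.
From mathcomp Require Import complex mxtens.

Set Implicit Arguments.
Unset Strict Implicit.
Unset Printing Implicit Defensive.

Import Order.TTheory GRing.Theory Num.Theory.
Import numFieldNormedType.Exports.

Local Open Scope classical_set_scope.
Local Open Scope ring_scope.
Local Open Scope complex_scope.

(* [f] is constant on each of finitely many disjoint open pieces whose closures
   cover the space; nothing is required of the values on the interfaces.  The
   pieces need not be connected, so that finitely many of them suffice for a
   function that is periodic in one variable. *)
Definition piecewise_constant (T : topologicalType) (V : Type) (f : T -> V) :=
  exists (n : nat) (U : 'I_n -> set T),
    [/\ forall i, open (U i),
        trivIset setT U,
        \bigcup_i closure (U i) = setT &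
        forall i, exists c : V, forall t, U i t -> f t = c].

Definition wavenumber (R : realType)
    (kappa : R -> R -> R[i]) (kappa_m kappa_p : R[i]) : Prop :=
  [/\ exists B : R, forall x z, `|kappa x z| <= B%:C,
      piecewise_constant (fun xz : R * R => kappa xz.1 xz.2),
      forall x, periodic (kappa x) 1,
      exists X : R, forall x z, x <= X -> kappa x z = kappa_m &
      exists X : R, forall x z, X <= x -> kappa x z = kappa_p].

Section LinearAlgebra.
Variable T : pzRingType.

(* The standard basis vector e_j with j counted from 1, as a column. *)
Definition evec n (j : nat) : 'cV[T]_n := \col_(i < n) (i.+1 == j)%:R.

Definition shiftmx n : 'M[T]_n := \matrix_(k < n, l < n) (k == l.+1 :> nat)%:R.

(* [mxvec] lists the rows of a matrix, hence the transpose. *)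
Definition vec m n (A : 'M[T]_(m, n)) : 'cV[T]_(n * m) := (mxvec A^T)^T.

(* v (x) I_n and v^T (x) I_n, with the dimension 1 * n rewritten to n. *)
Definition ckron1 m n (v : 'cV[T]_m) : 'M[T]_(m * n, n) :=
  castmx (erefl, mul1n n) (v *t (1%:M : 'M[T]_n)).
Definition rkron1 m n (v : 'rV[T]_m) : 'M[T]_(n, m * n) :=
  castmx (mul1n n, erefl) (v *t (1%:M : 'M[T]_n)).

End LinearAlgebra.

(* [mxvec] and the Kronecker product enumerate pairs of indices in the same
   order, so that diag (vec K) matches the Kronecker factors. *)
Lemma mxvec_indexE m n (i : 'I_m) (j : 'I_n) :
  mxvec_index i j = mxtens_index (i, j).
Proof.
apply: val_inj => /=.
rewrite /enum_rank [enum_rank_in]unlock insubdK; last first.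
  by rewrite -topredE /= cardE index_mem mem_enum.
rewrite enumT unlock /= /prod_enum.
have H (s : seq 'I_m) : i \in s ->
    index (i, j) [seq (x1, x2) | x1 <- s, x2 <- enum 'I_n] = (index i s * n + j)%N.
  elim: s => // a s IH; rewrite inE allpairs_cons index_cat /=.
  case: eqVneq => [->|ai] /= ins.
    rewrite map_f ?mem_enum // mul0n add0n index_map ?index_enum_ord //.
    by move=> x y [].
  rewrite ifN.
    by rewrite IH // size_map size_enum_ord mulSn addnA.
  by apply/mapP => -[y _ []] eia; rewrite eia eqxx in ai.
by rewrite H ?mem_enum // index_enum_ord.
Qed.

Lemma vecE (T : pzRingType) m n (A : 'M[T]_(m, n)) k l :
  vec A (mxtens_index (l, k)) 0 = A k l.
Proof. by rewrite mxE -mxvec_indexE mxvecE mxE. Qed.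

Definition expi (R : realType) (t : R) : R[i] := cos t +i* sin t.

Definition nz (p : nat) : nat := (2 * p + 1)%N.

Section Waveguide.
Variables (R : realType) (p nx : nat) (xm xp : R).
Variables (kappa : R -> R -> R[i]) (kappa_m kappa_p : R[i]).
Local Notation C := R[i].
Local Notation nz := (nz p).
Local Notation toCmx := (map_mx (real_complex R)).

Definition hx : R := (xp - xm) / (nx%:R + 1).
Definition hz : R := 1 / nz%:R.
Definition gridx (k : nat) : R := xm + k%:R * hx.
Definition gridz (l : nat) : R := l%:R * hz.

Definition Kmx : 'M[C]_(nz, nx) :=
  \matrix_(k < nz, l < nx) kappa (gridx l.+1) (gridz k.+1) ^+ 2.

Definition Dxx : 'M[R]_nx :=
  (hx ^+ 2)^-1 *: (- 2%:M + shiftmx R nx + (shiftmx R nx)^T).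

Definition Dz : 'M[R]_nz :=
  (2 * hz)^-1 *: (shiftmx R nz + evec R nz 1 *m (evec R nz nz)^T
                  - (shiftmx R nz)^T - evec R nz nz *m (evec R nz 1)^T).

Definition Dzz : 'M[R]_nz :=
  (hz ^+ 2)^-1 *: (- 2%:M + shiftmx R nz + evec R nz 1 *m (evec R nz nz)^T
                   + (shiftmx R nz)^T + evec R nz nz *m (evec R nz 1)^T).

Definition A0 : 'M[C]_(nx * nz) :=
  toCmx (Dxx^T) *t (1%:M : 'M[C]_nz) + (1%:M : 'M[C]_nx) *t toCmx Dzz
  + diag_mx (vec Kmx)^T.
Definition A1 : 'M[C]_(nx * nz) := 2 *: ((1%:M : 'M[C]_nx) *t toCmx Dz).
Definition A2 : 'M[C]_(nx * nz) := 1%:M.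

Definition Qmx (gamma : C) : 'M[C]_(nx * nz) :=
  A0 + gamma *: A1 + gamma ^+ 2 *: A2.

Definition d0 : R := - (3 / (2 * hx)).
Definition d1 : R := 2 / hx.
Definition d2 : R := - (1 / (2 * hx)).

Definition C1mx : 'M[C]_(nx * nz, nz + nz) :=
  ((hx ^+ 2)^-1)%:C *: row_mx (ckron1 nz (evec C nx 1))
                              (ckron1 nz (evec C nx nx)).

Definition C2Tmx : 'M[C]_(nz + nz, nx * nz) :=
  col_mx (rkron1 nz (d1%:C *: (evec C nx 1)^T)
          + rkron1 nz (d2%:C *: (evec C nx 2)^T))
         (rkron1 nz (d1%:C *: (evec C nx nx)^T)
          + rkron1 nz (d2%:C *: (evec C nx nx.-1)^T)).

Definition beta (kappa_pm gamma : C) (k : int) : C :=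
  (gamma + 'i * (2 * pi * k%:~R)%:C) ^+ 2 + kappa_pm ^+ 2.

(* [sqrtc] is the principal square root: nonnegative real part, and
   nonnegative imaginary part on the negative real axis.  The numClosedFieldType
   root [sqrtC] instead takes values in the upper half plane. *)
Definition sk (kappa_pm gamma : C) (k : int) : C :=
  (Num.sg (complex.Im (beta kappa_pm gamma k)))%:C * 'i
  * sqrtc (beta kappa_pm gamma k).

(* Ordinals start at 0: this is the entry in row k+1 and column l+1, whose
   frequency is (l+1) - p - 1 = l - p. *)
Definition Rmx : 'M[C]_nz :=
  \matrix_(k < nz, l < nz)
    expi (2 * pi * (l%:Z - p%:Z)%:~R * k.+1%:R * hz).

Definition Lambda (kappa_pm gamma : C) : 'M[C]_nz :=
  diag_mx (\row_(j < nz) (sk kappa_pm gamma (j%:Z - p%:Z) + d0%:C)).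

Definition Pside (kappa_pm gamma : C) : 'M[C]_nz :=
  Rmx *m Lambda kappa_pm gamma *m invmx Rmx.

Definition Pmx (gamma : C) : 'M[C]_(nz + nz) :=
  block_mx (Pside kappa_m gamma) 0 0 (Pside kappa_p gamma).

Definition Mmx (gamma : C) : 'M[C]_(nx * nz + (nz + nz)) :=
  block_mx (Qmx gamma) C1mx C2Tmx (Pmx gamma).

End Waveguide.

(* Main.v *)
Require Import Defs.
From mathcomp Require Import all_boot all_order all_algebra.
From mathcomp Require Import all_classical all_reals all_analysis.
From mathcomp Require Import complex mxtens.
Local Open Scope ring_scope.
Import GRing.Theory.

(** Block elimination. Subtracting [B *m invmx D] times the second block row from the first removes
    the unknown paired with [D] and leaves a system for [q] alone, with matrix [S]; the second row
    then gives the other unknown. [block_mx_schur] records this as a factorization and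
    [invmx_block_schur] solves with it. *)

Section SchurComplement.
Variables (T : comUnitRingType) (m n : nat).
Variables (A : 'M[T]_m) (B : 'M[T]_(m, n)) (C : 'M[T]_(n, m)) (D : 'M[T]_n).
Hypothesis D_unit : D \in unitmx.

Let S := A - B *m invmx D *m C.

Lemma block_mx_schur :
  block_mx A B C D = block_mx 1%:M (B *m invmx D) 0 1%:M *m block_mx S 0 C D.
Proof.
by rewrite mulmx_block !mul1mx !mul0mx !add0r mulmxKV // subrK.
Qed.

(** The first factor has determinant 1 and the second is block triangular, so the determinant is
    [\det S * \det D]. *)
Lemma unitmx_schur : (block_mx A B C D \in unitmx) = (S \in unitmx).
Proof.
rewrite block_mx_schur unitmxE det_mulmx det_ublock !det1 !mul1r det_lblock.
by rewrite unitrM -!unitmxE D_unit andbT.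
Qed.

Lemma invmx_block_schur (u : 'cV[T]_(m + n)) :
    let q := invmx S *m (usubmx u - B *m invmx D *m dsubmx u) in
    block_mx A B C D \in unitmx ->
  invmx (block_mx A B C D) *m u
    = col_mx q (invmx D *m (- (C *m q) + dsubmx u)).
Proof.
move=> q M_unit; have S_unit : S \in unitmx by rewrite -unitmx_schur.
apply: (canLR (mulKmx M_unit)).
(* The right factor sends the candidate to the reduced right-hand side stacked on [dsubmx u]; the
   left factor adds back [B *m invmx D *m dsubmx u], which restores [u]. *)
rewrite block_mx_schur -mulmxA !mul_block_col !mulKVmx // !mul0mx !mul1mx.
by rewrite addr0 add0r addrA subrr add0r subrK vsubmxK.
Qed.

End SchurComplement.

Theorem proposition2p2 (R : realType) (p nx : nat) (xm xp : R)
    (kappa : R -> R -> R[i]) (kappa_m kappa_p : R[i])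
    (nx_ge2 : (2 <= nx)%N) (xm_lt_xp : xm < xp)
    (kappaP : wavenumber kappa kappa_m kappa_p)
    (sigma : R[i])
    (r : 'cV[R[i]]_(nx * nz p + (nz p + nz p))) :
  let Q := Qmx p nx xm xp kappa sigma in
  let P := Pmx p nx xm xp kappa_m kappa_p sigma in
  let M := Mmx p nx xm xp kappa kappa_m kappa_p sigma in
  let C1 := C1mx p nx xm xp in
  let C2T := C2Tmx p nx xm xp in
  let S := Q - C1 *m invmx P *m C2T in
  let r_int := usubmx r in
  let r_ext := dsubmx r in
  let r_tilde := r_int - C1 *m invmx P *m r_ext in
  let q := invmx S *m r_tilde in
  P \in unitmx -> M \in unitmx ->
  S \in unitmx /\
  invmx M *m r = col_mx q (invmx P *m (- (C2T *m q) + r_ext)).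
Proof.
move=> Q P M C1 C2T S r_int r_ext r_tilde q P_unit M_unit; split.
  (* [invmx] returns a singular matrix unchanged, so this conjunct is what makes [invmx S] a true
     inverse in [q]. *)
  by rewrite -unitmx_schur.
exact: invmx_block_schur.
Qed.
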